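(* Let $r$ and $k$ be positive integers. Let $\Delta$ be a simplex with a sequence of heights $h_1,h_2,\ldots,h_k$. Suppose that the configuration $X$ satisfies $\mathbb{S}^{n-1-j}(h_j)\overset{j+1}{\rightarrow}X$ for each $1\le j\le k$. Then $\mathbb{E}^n\overset{r}{\rightarrow}(X;\Delta)_{\mathrm{GR}}$.
   Context: $\mathbb{E}^n$ denotes $n$-dimensional Euclidean space. An $r$-coloring of a set of points is an assignment to each of its points of one of $r$ colors (not all colors need be used). A set of points is monochromatic if all its points have the same color, and rainbow if its points have pairwise distinct colors. A simplex is identified with its (affinely independent) vertex set. A simplex $\Delta$ formed by points $\boldsymbol{x}_1,\ldots,\boldsymbol{x}_{k+2}$ has sequence of heights $h_1,\ldots,h_k$ if for each $3\le i\le k+2$ the distance from $\boldsymbol{x}_i$ to the affine space spanned by $\boldsymbol{x}_1,\ldots,\boldsymbol{x}_{i-1}$ is $h_{i-2}$. $\mathbb{S}^{d}(h)$ denotes the $d$-dimensional sphere (surface) of radius $h$, i.e. the set of points at distance $h$ from a fixed center in $\mathbb{E}^{d+1}$. $\mathbb{S}^{d}(h)\overset{s}{\rightarrow}X$ means that every $s$-coloring of $\mathbb{S}^d(h)$ contains a monochromatic set congruent (isometric) to $X$. $\mathbb{E}^n\overset{r}{\rightarrow}(K_1;K_2)_{\mathrm{GR}}$ means that every $r$-coloring of $\mathbb{E}^n$ contains either a monochromatic set congruent to $K_1$ or a rainbow set congruent to $K_2$. Here $n\ge k+1$, so that all the spheres $\mathbb{S}^{n-1-j}(h_j)$, $1\le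 j\le k$, are defined. *)

(* Defs.v *)
From mathcomp Require Import all_boot all_order all_algebra.
From mathcomp Require Import all_classical all_reals.

Set Implicit Arguments.
Unset Strict Implicit.
Unset Printing Implicit Defensive.

Import Order.TTheory GRing.Theory Num.Theory.
Local Open Scope classical_set_scope.
Local Open Scope ring_scope.

(* E^n is 'rV[R]_n with this distance; the norm that MathComp-Analysis puts on
   row vectors is the sup norm, so it cannot be used here. *)
Definition eucl_dist (R : realType) (n : nat) (u v : 'rV[R]_n) : R :=
  Num.sqrt (\sum_(i < n) (u 0 i - v 0 i) ^+ 2).

Definition dist_to_set (R : realType) (n : nat) (u : 'rV[R]_n)
    (A : set 'rV[R]_n) : R :=
  inf [set eucl_dist u v | v in A].

(* Isometry as metric subspaces; the two ambient dimensions may differ. *)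
Definition congruent (R : realType) (m n : nat)
    (A : set 'rV[R]_m) (B : set 'rV[R]_n) : Prop :=
  exists f : 'rV[R]_m -> 'rV[R]_n,
    f @` A = B /\
    forall u v, A u -> A v -> eucl_dist (f u) (f v) = eucl_dist u v.

Definition affine_independent (R : realType) (n : nat) (I : finType)
    (x : I -> 'rV[R]_n) : Prop :=
  forall a : I -> R,
    \sum_i a i = 0 -> \sum_i a i *: x i = 0 -> forall i, a i = 0.

Definition affine_span (R : realType) (n : nat) (I : finType) (P : pred I)
    (x : I -> 'rV[R]_n) : set 'rV[R]_n :=
  [set v | exists a : I -> R,
     \sum_(i | P i) a i = 1 /\ v = \sum_(i | P i) a i *: x i].

(* Indices start at 0: [x i] is the mathematical x_(i+1) and [h j] is h_(j+1).
   So [x (rshift 2 j)], whose index is j + 2, is x_(j+3), and its distance to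
   the span of x_1, ..., x_(j+2) is h_(j+1). *)
Definition simplex_with_heights (R : realType) (p k : nat)
    (Delta : set 'rV[R]_p) (h : 'I_k -> R) : Prop :=
  exists x : 'I_(2 + k) -> 'rV[R]_p,
    [/\ affine_independent x,
        Delta = range x &
        forall j : 'I_k,
          dist_to_set (x (rshift 2 j))
            (affine_span [pred l : 'I_(2 + k) | (l < rshift 2 j)%N] x) = h j].

Definition sphere (R : realType) (d : nat) (h : R) : set 'rV[R]_d.+1 :=
  [set u | eucl_dist u 0 = h].

Definition monochromatic (T C : Type) (f : T -> C) (A : set T) : Prop :=
  forall u v, A u -> A v -> f u = f v.

Definition rainbow (T C : Type) (f : T -> C) (A : set T) : Prop :=
  forall u v, A u -> A v -> f u = f v -> u = v.

(* A coloring of S is given by a function on the whole space, of which only the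
   values on S matter; for s > 0 every coloring of S arises in this way. *)
Definition mono_arrow (R : realType) (n : nat) (S : set 'rV[R]_n) (s : nat)
    (m : nat) (X : set 'rV[R]_m) : Prop :=
  forall f : 'rV[R]_n -> 'I_s,
    exists A : set 'rV[R]_n,
      [/\ A `<=` S, congruent X A & monochromatic f A].

Definition GR_arrow (R : realType) (n r : nat) (m1 m2 : nat)
    (K1 : set 'rV[R]_m1) (K2 : set 'rV[R]_m2) : Prop :=
  forall f : 'rV[R]_n -> 'I_r,
    (exists A : set 'rV[R]_n, congruent K1 A /\ monochromatic f A) \/
    (exists A : set 'rV[R]_n, congruent K2 A /\ rainbow f A).

(* Main.v *)
Require Import Defs.
From mathcomp Require Import all_boot all_order all_algebra.
From mathcomp Require Import all_classical all_reals.
From mathcomp Require Import ring lra zify.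

(** Call a colour fresh if it differs from those of the vertices already placed.
    A rainbow copy of the simplex is built vertex by vertex.

    If vertices x_0, ..., x_s of Delta have been copied to points y_0, ..., y_s
    of E^n with distinct colours, let c be the foot of the perpendicular from
    x_(s+1) to the affine span of x_0, ..., x_s, and let c' be the affine
    combination of the y_i with the same coefficients as c. By Pythagoras, every
    point at distance h from c' in the directions orthogonal to the y_i - y_0 is
    an admissible position for the next vertex, where h is the height of x_(s+1)
    ([dist_to_affine_span] identifies it with the distance to c). Those
    directions contain a subspace of dimension n - s
    ([orthonormal_complement]), so the admissible positions contain an isometric
    copy of the sphere of radius h in E^(n-s). Either one of them has a fresh
    colour and the copy grows, or the sphere uses only the s + 1 colours of the
    y_i and the arrow hypothesis yields a monochromatic copy of X. This
    dichotomy is [extend_partial_copy].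

    The induction starts from an edge, that is, from two points of different
    colours at the prescribed distance delta > 0. If there is no such pair, the
    colouring is constant, since in dimension at least 2 any two points are
    joined by a chain of steps of length delta ([constant_of_fixed_step]); then
    any copy of X is monochromatic, and the arrow hypothesis provides one. *)

Import Order.TTheory GRing.Theory Num.Theory.
Local Open Scope classical_set_scope.
Local Open Scope ring_scope.

(** * Inner product and Euclidean distance *)

Definition dot {R : realType} {n : nat} (u v : 'rV[R]_n) : R :=
  (u *m v^T) 0 0.

Section Dot.
Context {R : realType} {n : nat}.
Implicit Types u v w c : 'rV[R]_n.

Lemma dotE u v : dot u v = \sum_(i < n) u 0 i * v 0 i.
Proof. by rewrite /dot mxE; apply: eq_bigr => i _; rewrite mxE. Qed.

Lemma dotC u v : dot u v = dot v u.
Proof. by rewrite !dotE; apply: eq_bigr => i _; rewrite mulrC. Qed.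

Lemma dotDl u v w : dot (u + v) w = dot u w + dot v w.
Proof. by rewrite /dot mulmxDl mxE. Qed.

Lemma dotNl u w : dot (- u) w = - dot u w.
Proof. by rewrite /dot mulNmx mxE. Qed.

Lemma dotZl a u w : dot (a *: u) w = a * dot u w.
Proof. by rewrite /dot -scalemxAl mxE. Qed.

Lemma dotDr u v w : dot w (u + v) = dot w u + dot w v.
Proof. by rewrite dotC dotDl !(dotC w). Qed.

Lemma dotNr u w : dot w (- u) = - dot w u.
Proof. by rewrite dotC dotNl dotC. Qed.

Lemma dotZr a u w : dot w (a *: u) = a * dot w u.
Proof. by rewrite dotC dotZl dotC. Qed.

Lemma dot_sumr (I : finType) (P : pred I) (F : I -> 'rV[R]_n) w :
  dot w (\sum_(i | P i) F i) = \sum_(i | P i) dot w (F i).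
Proof.
apply: (big_morph (dot w)) => [u v|]; first exact: dotDr.
by rewrite /dot trmx0 mulmx0 mxE.
Qed.

Lemma dot_suml (I : finType) (P : pred I) (F : I -> 'rV[R]_n) w :
  dot (\sum_(i | P i) F i) w = \sum_(i | P i) dot (F i) w.
Proof. by rewrite dotC dot_sumr; apply: eq_bigr => i _; rewrite dotC. Qed.

Lemma dot_ge0 u : 0 <= dot u u.
Proof. by rewrite dotE sumr_ge0 // => i _; rewrite -expr2 sqr_ge0. Qed.

Lemma dot_eq0 u : dot u u = 0 -> u = 0.
Proof.
rewrite dotE => /eqP; rewrite psumr_eq0; last first.
  by move=> i _; rewrite -expr2 sqr_ge0.
move=> /allP u0; apply/rowP => i; rewrite mxE; apply/eqP.
by have := u0 i (mem_index_enum _); rewrite /= -expr2 sqrf_eq0.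
Qed.

Lemma eucl_distE u v : eucl_dist u v = Num.sqrt (dot (u - v) (u - v)).
Proof.
rewrite /eucl_dist dotE; congr Num.sqrt; apply: eq_bigr => i _.
by rewrite !mxE expr2.
Qed.

Lemma eucl_dist_sq u v : eucl_dist u v ^+ 2 = dot (u - v) (u - v).
Proof. by rewrite eucl_distE sqr_sqrtr ?dot_ge0. Qed.

Lemma eucl_dist_ge0 u v : 0 <= eucl_dist u v.
Proof. exact: sqrtr_ge0. Qed.

Lemma eucl_distC u v : eucl_dist u v = eucl_dist v u.
Proof. by rewrite !eucl_distE -(opprB v u) dotNl dotNr opprK. Qed.

Lemma eucl_distxx u : eucl_dist u u = 0.
Proof. by rewrite eucl_distE subrr /dot mul0mx mxE sqrtr0. Qed.

Lemma eucl_dist_eq0 u v : eucl_dist u v = 0 -> u = v.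
Proof.
move=> uv0; apply/eqP; rewrite -subr_eq0; apply/eqP/dot_eq0.
by rewrite -eucl_dist_sq uv0 expr0n.
Qed.

Lemma pythagoras u c v : dot (u - c) (c - v) = 0 ->
  eucl_dist u v ^+ 2 = eucl_dist u c ^+ 2 + eucl_dist c v ^+ 2.
Proof.
rewrite !eucl_dist_sq => ucv; rewrite -(subrKA c u (- v)).
move: (u - c) (c - v) ucv => a b ab0.
by rewrite dotDl !dotDr (dotC b a) ab0; ring.
Qed.

End Dot.

Lemma eucl_dist_sq_inj {R : realType} {m n : nat} (u v : 'rV[R]_m)
    (u' v' : 'rV[R]_n) :
  eucl_dist u v ^+ 2 = eucl_dist u' v' ^+ 2 -> eucl_dist u v = eucl_dist u' v'.
Proof.
by move/eqP; rewrite eqrXn2 ?eucl_dist_ge0 // => /eqP.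
Qed.

(** * Orthogonal complements *)

(** The diagonal entries of [A^T *m A] are the squared norms of the columns of
    [A]. *)
Lemma trmx_mul_eq0 {R : realType} {m n : nat} (A : 'M[R]_(m, n)) :
  A^T *m A = 0 -> A = 0.
Proof.
move=> A0; apply/trmx_inj/row_matrixP => i; rewrite trmx0 row0.
apply: dot_eq0; rewrite /dot tr_row trmxK -row_mul.
by rewrite colE mulmxA A0 mul0mx row0 mxE.
Qed.

(** The normal equations are solvable for an arbitrary [V], with dependent rows
    allowed, because the Gram matrix [V *m V^T] has the same row space as
    [V^T]: whatever it annihilates, [V^T] annihilates. *)
Lemma least_squares {R : realType} {N n : nat} (V : 'M[R]_(N, n))
    (w : 'rV[R]_n) :
  exists b : 'rV[R]_N, (w - b *m V) *m V^T = 0.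
Proof.
have VV : (V^T <= V *m V^T)%MS.
  rewrite submxE; apply/eqP/trmx_mul_eq0.
  by rewrite trmx_mul trmxK -!mulmxA (mulmxA V) mulmx_coker mulmx0.
have /submxP[b wb] : (w *m V^T <= V *m V^T)%MS.
  exact: submx_trans (submxMl _ _) VV.
by exists b; rewrite mulmxBl wb mulmxA subrr.
Qed.

(** Induction on [d]: a unit vector orthogonal to the rows of [W] is added to
    [W], so that the vectors found later are orthogonal to it as well. *)
Lemma orthonormal_complement {R : realType} {m d n : nat} (W : 'M[R]_(m, n)) :
  (d + m <= n)%N ->
  exists Q : 'M[R]_(d, n), Q *m Q^T = 1%:M /\ Q *m W^T = 0.
Proof.
elim: d m W => [|d IHd] m W dmn.
  by exists 0; split; apply/matrixP => -[].
have /rowV0Pn[v /sub_kermxP vW v0] : kermx W^T != 0.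
  rewrite -mxrank_eq0 mxrank_ker -lt0n subn_gt0.
  apply: leq_ltn_trans (rank_leq_col _) _; apply: leq_trans dmn.
  by rewrite ltnS leq_addl.
have vv0 : 0 < dot v v.
  by rewrite lt_def dot_ge0 andbT; apply: contra_neq v0 => /dot_eq0.
pose e := (Num.sqrt (dot v v))^-1 *: v.
have ee : e *m e^T = 1%:M.
  apply/matrixP => i j; rewrite !ord1 -/(dot e e) /e dotZl dotZr mxE eqxx mulrA.
  by rewrite -invfM -expr2 sqr_sqrtr ?dot_ge0 // mulVf ?gt_eqF.
have [|Q [QQ]] := IHd (1 + m)%N (col_mx e W); first by rewrite addnA addn1.
rewrite tr_col_mx mul_mx_row => /eqP.
rewrite row_mx_eq0 => /andP[/eqP Qe /eqP QW].
exists (col_mx e Q); rewrite -[d.+1]/(1 + d)%N; split.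
  rewrite tr_col_mx mul_col_row ee QQ Qe.
  have -> : e *m Q^T = 0 by apply: trmx_inj; rewrite trmx_mul trmxK Qe trmx0.
  by rewrite [RHS](@scalar_mx_block _ 1 d).
by rewrite mul_col_mx QW /e -scalemxAl vW scaler0 col_mx0.
Qed.

Lemma orthonormal_isometry {R : realType} {d n : nat} {Q : 'M[R]_(d, n)}
    (c : 'rV[R]_n) :
  Q *m Q^T = 1%:M ->
  forall u v, eucl_dist (c + u *m Q) (c + v *m Q) = eucl_dist u v.
Proof.
move=> QQ u v; rewrite !eucl_distE; congr Num.sqrt.
rewrite opprD addrACA subrr add0r -mulmxBl /dot trmx_mul mulmxA.
by rewrite -(mulmxA _ Q) QQ mulmx1.
Qed.

(** * Affine combinations and perpendicular feet *)

Lemma affine_comb_sub {R : realType} {n : nat} {I : finType} {P : pred I}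
    (a : I -> R) (x : I -> 'rV[R]_n) (z : 'rV[R]_n) :
  \sum_(i | P i) a i = 1 ->
  \sum_(i | P i) a i *: x i - z = \sum_(i | P i) a i *: (x i - z).
Proof.
move=> a1; under [RHS]eq_bigr do rewrite scalerBr.
by rewrite sumrB -scaler_suml a1 scale1r.
Qed.

Lemma orthogonal_affine_comb {R : realType} {n : nat} {I : finType} {P : pred I}
    {a : I -> R} {x : I -> 'rV[R]_n} {z u : 'rV[R]_n} :
  \sum_(i | P i) a i = 1 ->
  (forall i, P i -> dot u (x i - z) = 0) ->
  dot u (\sum_(i | P i) a i *: x i - z) = 0.
Proof.
move=> a1 ux; rewrite affine_comb_sub // dot_sumr big1 // => i Pi.
by rewrite dotZr ux ?mulr0.
Qed.

(** The foot of the perpendicular is the solution of a least-squares problem for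
    the differences [x i - x i0]. *)
Lemma exists_foot {R : realType} {N n : nat} {P : pred 'I_N}
    (x : 'I_N -> 'rV[R]_n) (w : 'rV[R]_n) (i0 : 'I_N) :
  P i0 ->
  exists a : 'I_N -> R, \sum_(i | P i) a i = 1 /\
    forall i, P i -> dot (w - \sum_(l | P l) a l *: x l) (x i - x i0) = 0.
Proof.
move=> Pi0; pose V := \matrix_(i < N) (if P i then x i - x i0 else 0).
have [b bV] := least_squares V (w - x i0).
pose a i : R := b 0 i + (i == i0)%:R * (1 - \sum_(l | P l) b 0 l).
exists a.
(* The weight left over goes to [x i0], whose row in [V] vanishes. *)
have a1 : \sum_(i | P i) a i = 1.
  rewrite big_split /= (bigD1 i0) //= [X in _ + X](bigD1 i0) //= eqxx mul1r.
  rewrite [X in _ + (_ + X)]big1 => [|i /andP[_ /negPf->]]; last first.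
    by rewrite mul0r.
  by rewrite addr0 -(bigD1 i0) //= addrC subrK.
have aV : \sum_(l | P l) a l *: x l = x i0 + b *m V.
  apply/eqP; rewrite addrC -subr_eq; apply/eqP.
  rewrite affine_comb_sub // mulmx_sum_row big_mkcond.
  apply: eq_bigr => i _; rewrite rowK; case: ifP => Pi; last first.
    by rewrite scaler0.
  rewrite /a; have [->|_] := eqVneq i i0; first by rewrite subrr !scaler0.
  by rewrite mul0r addr0.
split=> // i Pi; rewrite aV opprD addrA.
have -> : x i - x i0 = row i V by rewrite rowK Pi.
by rewrite /dot tr_row colE mulmxA bV mul0mx mxE.
Qed.

(** By Pythagoras, no point of the span is nearer to [w] than the foot. *)
Lemma dist_to_affine_span {R : realType} {N n : nat} {P : pred 'I_N}
    {x : 'I_N -> 'rV[R]_n} {w : 'rV[R]_n} {i0 : 'I_N} {a : 'I_N -> R} :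
  \sum_(i | P i) a i = 1 ->
  (forall i, P i -> dot (w - \sum_(l | P l) a l *: x l) (x i - x i0) = 0) ->
  dist_to_set w (affine_span P x) = eucl_dist w (\sum_(l | P l) a l *: x l).
Proof.
move=> a1 wx; set c := \sum_(l | P l) _ in wx *.
have lb : lbound [set eucl_dist w v | v in affine_span P x] (eucl_dist w c).
  move=> _ [v [b [b1 ->]] <-].
  set z := \sum_(l | P l) b l *: _.
  have : dot (w - c) (c - z) = 0.
    rewrite -(subrKA (x i0) c (- z)) dotDr -(opprB z) dotNr.
    by rewrite !orthogonal_affine_comb // oppr0 addr0.
  move/pythagoras => wz.
  by rewrite -(@ler_pXn2r _ 2) ?nnegrE ?eucl_dist_ge0 // wz lerDl sqr_ge0.
have inS : [set eucl_dist w v | v in affine_span P x] (eucl_dist w c).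
  by exists c => //; exists a.
apply/eqP; rewrite eq_le; apply/andP; split.
  by apply: ge_inf => //; exists (eucl_dist w c).
by apply: lb_le_inf => //; exists (eucl_dist w c).
Qed.

(** Mutual distances determine the inner products of the differences [x i - x l]
    by polarization, hence also the norms of their linear combinations. *)
Lemma affine_comb_dist {R : realType} {I : finType} {P : pred I} {m n : nat}
    {x : I -> 'rV[R]_m} {y : I -> 'rV[R]_n} {a : I -> R} {l : I} :
  \sum_(i | P i) a i = 1 -> P l ->
  (forall i j, P i -> P j -> eucl_dist (y i) (y j) = eucl_dist (x i) (x j)) ->
  eucl_dist (\sum_(i | P i) a i *: y i) (y l) =
  eucl_dist (\sum_(i | P i) a i *: x i) (x l).
Proof.
move=> a1 Pl yx; rewrite !eucl_distE !affine_comb_sub // !dot_suml.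
congr Num.sqrt; apply: eq_bigr => i Pi; rewrite !dot_sumr.
apply: eq_bigr => j Pj; rewrite !(dotZl, dotZr); congr (_ * (_ * _)).
have polar q (z : I -> 'rV[R]_q) : 2 * dot (z i - z l) (z j - z l) =
    eucl_dist (z i) (z l) ^+ 2 + eucl_dist (z j) (z l) ^+ 2
    - eucl_dist (z i) (z j) ^+ 2.
  rewrite !eucl_dist_sq !(dotDl, dotDr, dotNl, dotNr).
  by rewrite (dotC (z j) (z i)) (dotC (z l) (z i)) (dotC (z l) (z j)); ring.
by apply: (@mulfI _ 2); rewrite ?pnatr_eq0 // !polar !yx.
Qed.

(** Two equal points with distinct indices satisfy the forbidden relation with
    weights 1 and -1. *)
Lemma affine_independent_inj {R : realType} {n : nat} {I : finType}
    {x : I -> 'rV[R]_n} :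
  affine_independent x -> injective x.
Proof.
move=> x_indep i l xil; apply/eqP/negPn/negP => il.
have pick (V : lmodType R) (z : I -> V) j : \sum_i' (i' == j)%:R *: z i' = z j.
  rewrite (bigD1 j) //= eqxx scale1r big1 ?addr0 // => i' /negPf->.
  by rewrite scale0r.
have /(_ i)/eqP : forall j, (j == i)%:R - (j == l)%:R = 0 :> R.
  apply: x_indep.
    have pick1 := pick R^o (fun=> 1).
    rewrite sumrB; apply/eqP; rewrite subr_eq0; apply/eqP.
    transitivity (1 : R); last symmetry.
      by rewrite -[RHS](pick1 i); apply: eq_bigr => j _; rewrite [RHS]mulr1.
    by rewrite -[RHS](pick1 l); apply: eq_bigr => j _; rewrite [RHS]mulr1.
  under eq_bigr do rewrite scalerBl.
  by rewrite sumrB !pick xil subrr.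
by rewrite eqxx (negPf il) subr0 oner_eq0.
Qed.

(** * Colourings *)

Lemma congruent_image {R : realType} {m d n : nat} {X : set 'rV[R]_m}
    {A : set 'rV[R]_d} (g : 'rV[R]_d -> 'rV[R]_n) :
  (forall u v, eucl_dist (g u) (g v) = eucl_dist u v) ->
  congruent X A -> congruent X (g @` A).
Proof.
move=> g_iso [q [<- q_iso]]; exists (g \o q).
split=> [|u v Xu Xv]; last by rewrite /= g_iso q_iso.
by rewrite image_comp.
Qed.

(** Two points at distance at most [delta] have a common neighbour at distance
    exactly [delta], the apex of an isosceles triangle; two arbitrary points are
    joined by a segment cut into short pieces. *)
Lemma constant_of_fixed_step {R : realType} {n : nat} {C : Type}
    {f : 'rV[R]_n -> C} {delta : R} :
  (1 < n)%N -> 0 < delta ->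
  (forall u v, eucl_dist u v = delta -> f u = f v) ->
  forall u v, f u = f v.
Proof.
move=> n1 delta0 f_delta.
have f_close u v : eucl_dist u v <= delta -> f u = f v.
  move=> uv; have [z zE] : exists z, z = 2^-1 *: (v - u).
    by exists (2^-1 *: (v - u)).
  have [Q [QQ Qz]] := @orthonormal_complement R 1 1 n z n1.
  have QQ1 : dot Q Q = 1 by rewrite /dot QQ mxE eqxx.
  have Qz0 : dot Q z = 0 by rewrite /dot Qz mxE.
  pose s := Num.sqrt (delta ^+ 2 - dot z z).
  have zz : dot z z = eucl_dist u v ^+ 2 / 4.
    by rewrite zE dotZl dotZr eucl_distC eucl_dist_sq; field.
  have s2 : s ^+ 2 = delta ^+ 2 - dot z z.
    rewrite sqr_sqrtr // zz subr_ge0.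
    have : eucl_dist u v ^+ 2 <= delta ^+ 2.
      by rewrite ler_pXn2r ?nnegrE ?eucl_dist_ge0 ?(ltW delta0).
    by have := sqr_ge0 (eucl_dist u v); lra.
  have norm_sz (e : R) : e ^+ 2 = 1 ->
      Num.sqrt (dot (s *: Q + e *: z) (s *: Q + e *: z)) = delta.
    move=> e2; rewrite -[RHS](ger0_norm (ltW delta0)) -sqrtr_sqr.
    congr Num.sqrt; rewrite !(dotDl, dotDr, dotZl, dotZr) (dotC z Q) Qz0 QQ1.
    transitivity (s ^+ 2 + e ^+ 2 * dot z z); first by ring.
    by rewrite s2 e2; ring.
  pose w := u + (s *: Q + 1 *: z).
  (* [w] is the apex: [z] is half the base, the unit vector [Q] is orthogonal to
     it, and [s] is the altitude. *)
  have wv : w = v + (s *: Q + (- 1) *: z).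
    by rewrite /w zE; apply/rowP => i; rewrite !mxE; field.
  transitivity (f w); last symmetry; apply: f_delta.
  - by rewrite eucl_distC eucl_distE /w addrC addKr norm_sz ?expr1n.
  - by rewrite eucl_distC eucl_distE wv addrC addKr norm_sz // sqrrN expr1n.
move=> u v; pose N := (Num.bound (eucl_dist u v / delta)).+1.
pose st := N%:R^-1 *: (v - u).
have N0 : 0 < N%:R :> R by rewrite ltr0n.
have st_small : eucl_dist 0 st <= delta.
  rewrite eucl_distE sub0r dotNl dotNr opprK /st dotZl dotZr mulrA -expr2.
  rewrite sqrtrM ?sqr_ge0 // sqrtr_sqr ger0_norm ?invr_ge0 ?ler0n //.
  rewrite -eucl_distE eucl_distC mulrC ler_pdivrMr // mulrC -ler_pdivrMr //.
  have := archi_boundP (divr_ge0 (eucl_dist_ge0 u v) (ltW delta0)).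
  move/ltW/le_trans.
  by apply; rewrite ler_nat.
have walk t : f (u + st *+ t) = f u.
  elim: t => [|t <-]; first by rewrite addr0.
  apply/esym/f_close; apply: le_trans st_small.
  by rewrite !eucl_distE mulrSr addrA opprD addrA subrr.
rewrite -(walk N); congr f; rewrite /st -scaler_nat scalerA mulfV ?gt_eqF //.
by rewrite scale1r addrC subrK.
Qed.

(** The restriction of [y] to the first [t] indices is a rainbow copy of that of
    [x]; its other values are junk. *)
Definition partial_copy {R : realType} {N p n : nat} {C : Type}
    (x : 'I_N -> 'rV[R]_p) (f : 'rV[R]_n -> C) (t : nat)
    (y : 'I_N -> 'rV[R]_n) : Prop :=
  forall i l : 'I_N, (i < t)%N -> (l < t)%N ->
    eucl_dist (y i) (y l) = eucl_dist (x i) (x l) /\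
    (f (y i) = f (y l) -> i = l).

(** The sphere around the point [c'] that corresponds to the foot of [x t], in
    directions orthogonal to the points already placed, consists of admissible
    positions for the next vertex: either one of them has a fresh colour, or the
    [s.+1] old colours cover the whole sphere. *)
Lemma extend_partial_copy {R : realType} {N p n m s d : nat} {C : Type}
    {x : 'I_N.+1 -> 'rV[R]_p} {f : 'rV[R]_n -> C} {y : 'I_N.+1 -> 'rV[R]_n}
    {X : set 'rV[R]_m} {t : 'I_N.+1} {h : R} :
  t = s.+1 :> nat -> (d.+1 + s <= n)%N ->
  dist_to_set (x t) (affine_span [pred l : 'I_N.+1 | (l < t)%N] x) = h ->
  mono_arrow (@sphere R d h) s.+1 X ->
  partial_copy x f t y ->
  (exists A : set 'rV[R]_n, congruent X A /\ monochromatic f A) \/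
  exists y' : 'I_N.+1 -> 'rV[R]_n, partial_copy x f t.+1 y'.
Proof.
move=> ts dsn ht hX y_copy; pose P := [pred l : 'I_N.+1 | (l < t)%N].
have P0 : P ord0 by rewrite /= ts.
have [a [a1 a_foot]] := exists_foot x (x t) ord0 P0.
rewrite (dist_to_affine_span a1 a_foot) in ht.
pose W := \matrix_(i < s) (y (inord i.+1) - y ord0).
have [Q [QQ QW]] := @orthonormal_complement R s d.+1 n W dsn.
have Qy u i : P i -> dot (u *m Q) (y i - y ord0) = 0.
  move=> /= it; case: (posnP i) => [i0|i_gt0].
    have -> : i = ord0 by apply: val_inj.
    by rewrite subrr /dot trmx0 mulmx0 mxE.
  have iW : (i.-1 < s)%N by rewrite -ltnS prednK // -ts.
  have -> : y i - y ord0 = row (Ordinal iW) W.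
    by rewrite rowK /= prednK // inord_val.
  by rewrite /dot tr_row colE mulmxA -(mulmxA u) QW mulmx0 mul0mx mxE.
set c := \sum_(l | _) _ in a_foot ht.
pose c' := \sum_(l | P l) a l *: y l.
pose g u := c' + u *m Q.
have g_iso := orthonormal_isometry c' QQ.
have y_dist i l : P i -> P l -> eucl_dist (y i) (y l) = eucl_dist (x i) (x l).
  by move=> Pi Pl; have [] := y_copy i l Pi Pl.
have sphere_dist u l : sphere h u -> P l ->
    eucl_dist (g u) (y l) = eucl_dist (x t) (x l).
  move=> hu Pl; apply: eucl_dist_sq_inj.
  rewrite (@pythagoras _ _ (g u) c'); last first.
    rewrite /g addrC addKr -(subrKA (y ord0) c' (- y l)) dotDr.
    rewrite -(opprB (y l)) dotNr Qy // oppr0 addr0.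
    by apply: orthogonal_affine_comb => // i; exact: Qy.
  rewrite (@pythagoras _ _ (x t) c); last first.
    rewrite -(subrKA (x ord0) c (- x l)) dotDr -(opprB (x l)) dotNr.
    rewrite a_foot // oppr0 addr0.
    exact: orthogonal_affine_comb.
  congr (_ ^+ 2 + _ ^+ 2); last exact: affine_comb_dist.
  rewrite ht -hu -(g_iso u 0) mul0mx addr0 //.
case: (pselect (exists2 u, sphere h u & forall l, P l -> f (g u) <> f (y l))).
  move=> [u hu u_new]; right.
  exists (fun i => if i == t then g u else y i) => i l.
  rewrite !ltnS [(i <= t)%N]leq_eqVlt [(l <= t)%N]leq_eqVlt !(inj_eq val_inj).
  have [->|_] := eqVneq i t; have [->|_] := eqVneq l t => //= Pi Pl.
  - by rewrite !eucl_distxx.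
  - by split; [exact: sphere_dist | move/(u_new l Pl)].
  - rewrite eucl_distC (eucl_distC (x i)).
    by split; [exact: sphere_dist | move/esym/(u_new i Pi)].
  - exact: y_copy.
move=> no_new; left.
have old u : exists l, sphere h u -> P l /\ f (g u) = f (y l).
  case: (pselect (sphere h u)) => hu; last by exists ord0.
  apply: contrapT => none; apply: no_new; exists u => // l Pl ful.
  by apply: none; exists l.
(* Recolour each point of the sphere by the index of an earlier vertex of the
   same colour, since the arrow hypothesis wants colours in ['I_s.+1]. *)
have [q q_old] := boolp.choice old.
have [A [Ah XA A_mono]] := hX (fun u => inord (q u)).
exists (g @` A); split; first exact: congruent_image g_iso XA.
move=> _ _ [u Au <-] [v Av <-].
have [Pu ->] := q_old u (Ah u Au); have [Pv ->] := q_old v (Ah v Av).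
have /(congr1 (@nat_of_ord _)) := A_mono u v Au Av.
by rewrite !inordK -?ts // => /val_inj ->.
Qed.

(** A congruence is a function of points, while [y] is a function of indices; it
    factors through [x] because points at distance 0 are equal. *)
Lemma partial_copy_congruent {R : realType} {N p n : nat} {C : Type}
    {x : 'I_N -> 'rV[R]_p} {f : 'rV[R]_n -> C} {y : 'I_N -> 'rV[R]_n} :
  partial_copy x f N y ->
  congruent (range x) (range y) /\ rainbow f (range y).
Proof.
move=> y_copy; have y_dist i l : eucl_dist (y i) (y l) = eucl_dist (x i) (x l).
  by have [] := y_copy i l (ltn_ord i) (ltn_ord l).
split; last first.
  move=> _ _ [i _ <-] [l _ <-] fil.
  by have [_ ->] := y_copy i l (ltn_ord i) (ltn_ord l).
have yq u : exists v, forall i, x i = u -> y i = v.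
  case: (pselect (exists i, x i = u)) => [[i <-]|no_i]; last first.
    by exists 0 => i xi; case: no_i; exists i.
  by exists (y i) => l xl; apply: eucl_dist_eq0; rewrite y_dist xl eucl_distxx.
have [q qE] := boolp.choice yq.
have qx i : q (x i) = y i by rewrite (qE (x i) i).
exists q; split; last by move=> _ _ [i _ <-] [l _ <-]; rewrite !qx.
rewrite image_comp; apply: eq_imagel => i _; exact: qx.
Qed.

(** Without such a pair the colouring is constant, so every copy of [X] in the
    ambient space is monochromatic; the arrow hypothesis provides one. *)
Lemma exists_bicolored_pair {R : realType} {n m d : nat} {C : Type}
    {f : 'rV[R]_n -> C} {X : set 'rV[R]_m} {S : set 'rV[R]_d} {s : nat}
    {delta : R} :
  (1 < n)%N -> (d <= n)%N -> 0 < delta -> mono_arrow S s.+1 X ->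
  (exists A : set 'rV[R]_n, congruent X A /\ monochromatic f A) \/
  exists u v, eucl_dist u v = delta /\ f u <> f v.
Proof.
move=> n1 dn delta0 hX.
case: (pselect (exists u v, eucl_dist u v = delta /\ f u <> f v)).
  by right.
move=> no_pair; left; have f_const : forall u v, f u = f v.
  apply: (constant_of_fixed_step n1 delta0) => u v uv; apply: contrapT => fuv.
  by apply: no_pair; exists u, v.
have [A [_ XA _]] := hX (fun=> ord0).
(* Only an isometric embedding of the smaller space is wanted, so the family to
   be orthogonal to is empty. *)
have [|Q [QQ _]] := @orthonormal_complement R 0 d n 0; first by rewrite addn0.
exists ((fun u => 0 + u *m Q) @` A); split; last by move=> u v _ _.
exact: congruent_image (orthonormal_isometry 0 QQ) XA.
Qed.

(* [j : 'I_k] stands for the mathematical index j + 1 in {1, ..., k}. *)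
Theorem theorem1p6 (R : realType) (r k n p m : nat)
    (Delta : set 'rV[R]_p) (h : 'I_k -> R) (X : set 'rV[R]_m)
    (hr : (0 < r)%N) (hk : (0 < k)%N) (hn : (k.+1 <= n)%N)
    (hDelta : simplex_with_heights Delta h)
    (hX : forall j : 'I_k,
      mono_arrow (@sphere R (n - 1 - j.+1) (h j)) j.+2 X) :
  GR_arrow n r X Delta.
Proof.
move=> f; case: hDelta => x [x_indep -> x_height].
case: (pselect (exists A, congruent X A /\ monochromatic f A)); first by left.
move=> no_mono; right.
suff [y /partial_copy_congruent[]] : exists y, partial_copy x f (2 + k) y.
  by exists (range y).
pose x0 : 'I_(2 + k) := ord0; pose x1 : 'I_(2 + k) := lift ord0 ord0.
have x01 : 0 < eucl_dist (x x0) (x x1).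
  rewrite lt_def eucl_dist_ge0 andbT; apply/eqP => /eucl_dist_eq0.
  by move/(affine_independent_inj x_indep).
have base : exists y, partial_copy x f 2 y.
  have [||/no_mono//|[u [v [uv fuv]]]] :=
    exists_bicolored_pair (f := f) _ _ x01 (hX (Ordinal hk)); [lia..|].
  exists (fun i => if i == x0 then u else v) => i l.
  have lt2 (i' : 'I_(2 + k)) : (i' < 2)%N -> i' = x0 \/ i' = x1.
    by case: i' => [[|[|i']] lti'] // _; [left | right]; apply: val_inj.
  have x10 : (x1 == x0) = false by [].
  move=> /lt2[]-> /lt2[]->; rewrite ?x10 ?eqxx ?eucl_distxx //.
  by rewrite eucl_distC uv eucl_distC; split=> [|/esym/fuv].
suff : forall t, (t <= k)%N -> exists y, partial_copy x f (2 + t) y by exact.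
elim=> [//|t IHt] tk; have [y y_copy] := IHt (ltnW tk).
pose j := Ordinal tk.
have [||/no_mono|[y' y'_copy]] :=
  extend_partial_copy (t := rshift 2 j) _ _ (x_height j) (hX j) y_copy.
- by [].
- by rewrite /=; lia.
- by [].
- by exists y'.
Qed.
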